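(* Let $n>2$ and $V=\mathbb{F}_2^n$. If $\Sigma$ is a Sylow $2$-subgroup of $\mathrm{AGL}(V)$, then $[N_{\mathrm{Sym}(V)}(\Sigma):\Sigma]=2$.
   Context: $\mathrm{AGL}(V)$ is the affine group of maps $x\mapsto xL+v$ with $L\in\mathrm{GL}(V)$, $v\in V$, viewed as a subgroup of $\mathrm{Sym}(V)$. *)

(* Defs.v *)
From HB Require Import structures.
From mathcomp Require Import all_boot all_order all_algebra all_fingroup all_solvable.
Set Implicit Arguments. Unset Strict Implicit. Unset Printing Implicit Defensive.
Import GRing.Theory.
Local Open Scope ring_scope.

Definition AGL (n : nat) : {set {perm 'rV['F_2]_n}} :=
  [set p : {perm 'rV['F_2]_n} |
    [exists L : 'M['F_2]_n, (L \in unitmx) &&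
      [exists v : 'rV['F_2]_n, [forall x : 'rV['F_2]_n, p x == x *m L + v]]]].

(* Main.v *)
Require Import Defs.
From HB Require Import structures.
From mathcomp Require Import all_boot all_order all_algebra all_fingroup all_solvable.
From mathcomp Require Import ring.

(* Up to conjugacy, Sigma is the group Sigma0 of affine maps that are unipotent
   triangular for the standard flag: p(x)_i - x_i depends only on the x_j with
   j < i.  Its normalizer preserves the flag, hence is triangular as well.  An
   element g of the normalizer has affine coordinates except possibly the last
   one, because the shears of Sigma0 in the last coordinate are permuted by g;
   so, modulo Sigma0, g is a shear by a function f in the last direction.  Such
   a shear normalizes Sigma0 only if f o p - f is affine for all p in Sigma0.
   Translations p make f quadratic, and transvections p make its alternating
   polar form a multiple of e_0* /\ e_1*.  Hence f is affine or affine plus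
   x_0 x_1, and the latter gives the nontrivial coset. *)

Set Implicit Arguments. Unset Strict Implicit. Unset Printing Implicit Defensive.
Import GRing.Theory.
Local Open Scope ring_scope.

(** * Arithmetic over F_2 *)

Lemma F2P (a : 'F_2) : a = 0 \/ a = 1.
Proof. by case: a => [[|[|//]] h]; [left|right]; apply: val_inj. Qed.

Lemma F2_addrr (a : 'F_2) : a + a = 0.
Proof. by case: (F2P a) => ->; apply/eqP. Qed.

(** Identities in a few variables over the two-element field are settled by trying all values. *)
Ltac F2_decide := repeat match goal with
  | a : _ |- _ => case: (F2P a) => ?; subst a
  end;
  first [by apply/eqP | let E := fresh in intro E; apply/eqP; move: E; done].

Lemma F2_oppr (a : 'F_2) : - a = a.
Proof. by apply/eqP; rewrite eq_sym -addr_eq0 F2_addrr. Qed.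

Lemma F2_addrr_row n (x : 'rV['F_2]_n) : x + x = 0.
Proof. by apply/rowP => i; rewrite !mxE F2_addrr. Qed.

(** * Affine maps and the standard flag *)

(** Over F_2 additive maps are linear, so this identity captures affinity without a matrix. *)
Definition is_affine n (W : zmodType) (f : 'rV['F_2]_n -> W) :=
  [forall x, forall y, f (x + y) + f 0 == f x + f y].

(* [x] and [y] are congruent modulo the [i]-th term of the standard flag. *)
Definition agree n (i : nat) (x y : 'rV['F_2]_n) :=
  [forall j : 'I_n, (j < i)%N ==> (x 0 j == y 0 j)].

(** Affinity is left out so that the notion also fits elements of the normalizer. *)
Definition unitri n (p : {perm 'rV['F_2]_n}) :=
  [forall x, forall y, forall i : 'I_n,
    agree i x y ==> (p x 0 i - x 0 i == p y 0 i - y 0 i)].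

Lemma affineP n (W : zmodType) (f : 'rV['F_2]_n -> W) :
  reflect (forall x y, f (x + y) + f 0 = f x + f y) (is_affine f).
Proof.
apply: (iffP forallP) => [h x y|h x]; first by have /forallP/(_ y)/eqP := h x.
by apply/forallP => y; apply/eqP.
Qed.

Lemma agreeP n i (x y : 'rV['F_2]_n) :
  reflect (forall j : 'I_n, (j < i)%N -> x 0 j = y 0 j) (agree i x y).
Proof.
apply: (iffP forallP) => [h j ji|h j]; first by have := h j; rewrite ji => /eqP.
by apply/implyP => ji; apply/eqP/h.
Qed.

Lemma unitriP n (p : {perm 'rV['F_2]_n}) :
  reflect (forall x y (i : 'I_n), agree i x y -> p x 0 i - x 0 i = p y 0 i - y 0 i)
          (unitri p).
Proof.
apply: (iffP forallP) => [h x y i a|h x].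
  by have /forallP/(_ y)/forallP/(_ i) := h x; rewrite a => /eqP.
apply/forallP => y; apply/forallP => i; apply/implyP => a; apply/eqP; exact: h.
Qed.

Lemma agreeC n i (x y : 'rV['F_2]_n) : agree i x y = agree i y x.
Proof. by apply/agreeP/agreeP => h j /h. Qed.

Lemma agreeW n i j (x y : 'rV['F_2]_n) : (i <= j)%N -> agree j x y -> agree i x y.
Proof. by move=> ij /agreeP h; apply/agreeP => k ki; apply: h; apply: leq_trans ij. Qed.

Lemma agree0 n (x y : 'rV['F_2]_n) : agree 0 x y.
Proof. exact/agreeP. Qed.

Lemma agreeS n (i : 'I_n) (x y : 'rV['F_2]_n) :
  agree i.+1 x y = agree i x y && (x 0 i == y 0 i).
Proof.
apply/agreeP/andP => [h|[/agreeP h /eqP hi] j].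
  by split; [apply/agreeP => j ji; apply: h; apply: ltnW | apply/eqP/h].
rewrite ltnS leq_eqVlt => /orP[/eqP/val_inj->//|]; exact: h.
Qed.

Lemma agree_eq n (x y : 'rV['F_2]_n) : agree n x y -> x = y.
Proof. by move=> /agreeP h; apply/rowP => i; apply: h. Qed.

Lemma agree_add_delta n (i : 'I_n) (x : 'rV['F_2]_n) : agree i (x + delta_mx 0 i) x.
Proof.
apply/agreeP => j ji; rewrite !mxE eqxx /=.
by case: eqP ji => [->|_ _]; rewrite ?ltnn ?addr0.
Qed.

Lemma affine_comp n (W : zmodType) (p : 'rV['F_2]_n -> 'rV['F_2]_n)
    (f : 'rV['F_2]_n -> W) :
  is_affine p -> is_affine f -> is_affine (f \o p).
Proof.
by move=> /affineP hp /affineP hf; apply/affineP => x y /=; rewrite -hf hp hf.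
Qed.

Lemma affineD n (W : zmodType) (f g : 'rV['F_2]_n -> W) :
  is_affine f -> is_affine g -> is_affine (fun x => f x + g x).
Proof.
by move=> /affineP hf /affineP hg; apply/affineP => x y; rewrite addrACA hf hg addrACA.
Qed.

Lemma affine_id n : is_affine (@id 'rV['F_2]_n).
Proof. by apply/affineP => x y; rewrite addr0. Qed.

Lemma affine_cst n (W : zmodType) (c : W) : is_affine (fun _ : 'rV['F_2]_n => c).
Proof. exact/affineP. Qed.

Lemma affine_coord n (i : 'I_n) : is_affine (fun x : 'rV['F_2]_n => x 0 i).
Proof. by apply/affineP => x y; rewrite !mxE addr0. Qed.

Lemma affine_coordP n (p : 'rV['F_2]_n -> 'rV['F_2]_n) :
  reflect (forall i, is_affine (fun x => p x 0 i)) (is_affine p).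
Proof.
apply: (iffP idP) => [hp i|h]; first exact: affine_comp hp (affine_coord i).
by apply/affineP => x y; apply/rowP => i; have /affineP := h i; rewrite !mxE; apply.
Qed.

Lemma affineZ n (f : 'rV['F_2]_n -> 'F_2) (w : 'rV['F_2]_n) :
  is_affine f -> is_affine (fun x => f x *: w).
Proof. by move=> /affineP h; apply/affineP => x y; rewrite -!scalerDl h. Qed.

(** Subtracting [p 0] leaves an additive, hence linear, map; injectivity of [p] makes its matrix
    invertible. *)
Lemma AGL_affine n : AGL n = [set p : {perm 'rV['F_2]_n} | is_affine p].
Proof.
apply/setP => p; rewrite !inE; apply/existsP/affineP => [[L /andP[_]]|h].
  move=> /existsP[v /forallP h] x y.
  by rewrite !(eqP (h _)) mulmxDl mul0mx add0r -addrA addrACA.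
pose A (x : 'rV['F_2]_n) := p x - p 0.
have A_add x y : A (x + y) = A x + A y.
  by rewrite /A addrACA -h -addrA; congr (_ + _); rewrite addrA subrr add0r.
have A0 : A 0 = 0 by rewrite /A subrr.
have A_lin : linear A.
  move=> a x y; rewrite A_add; congr (_ + _).
  by case: (F2P a) => ->; rewrite ?scale0r ?scale1r.
pose Al := GRing.isLinear.Build _ _ _ _ A A_lin.
pose AL : {linear 'rV['F_2]_n -> 'rV['F_2]_n} := HB.pack A Al.
have ALE x : x *m lin1_mx AL = A x by rewrite mul_rV_lin1.
exists (lin1_mx AL); apply/andP; split.
  rewrite -row_free_unit; apply/inj_row_free => v; rewrite ALE => /eqP.
  by rewrite subr_eq0 => /eqP/perm_inj.
by apply/existsP; exists (p 0); apply/forallP => x; rewrite ALE subrK.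
Qed.

Lemma AGL_group_set n : group_set (AGL n).
Proof.
rewrite AGL_affine; apply/group_setP; split => [|p q].
  by rewrite inE; apply/affineP => x y; rewrite !perm1 addr0.
rewrite !inE => hp hq; have /affineP h := affine_comp hp hq.
by apply/affineP => x y; rewrite !permM; apply: h.
Qed.
Canonical AGL_group n := Group (AGL_group_set n).

(** * The 2-group of unitriangular affine maps *)

Lemma unitri_agree n (p : {perm 'rV['F_2]_n}) i x y :
  unitri p -> agree i x y -> agree i (p x) (p y).
Proof.
move=> /unitriP hp a; apply/agreeP => j ji; have /agreeP/(_ j ji) e := a.
have := hp _ _ _ (agreeW (ltnW ji) a); rewrite e; exact: addIr.
Qed.

Lemma unitriM n (p q : {perm 'rV['F_2]_n}) : unitri p -> unitri q -> unitri (p * q)%g.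
Proof.
move=> hp hq; apply/unitriP => x y i a; rewrite !permM.
have /unitriP/(_ _ _ _ (unitri_agree hp a)) e1 := hq.
have /unitriP/(_ _ _ _ a) e2 := hp.
by rewrite -(subrK (p x 0 i) (q _ 0 i)) -addrA e1 e2 addrA subrK.
Qed.

Definition Sigma0 n : {set {perm 'rV['F_2]_n}} := [set p in AGL n | unitri p].

Lemma Sigma0P n (p : {perm 'rV['F_2]_n}) : (p \in Sigma0 n) = is_affine p && unitri p.
Proof. by rewrite inE AGL_affine inE. Qed.

Lemma Sigma0_group_set n : group_set (Sigma0 n).
Proof.
apply/group_setP; split => [|p q].
  apply/setIdP; split; first exact: group1.
  by apply/unitriP => x y i _; rewrite !perm1 !subrr.
move=> /setIdP[pA pT] /setIdP[qA qT].
by apply/setIdP; split; [exact: groupM | exact: unitriM].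
Qed.
Canonical Sigma0_group n := Group (Sigma0_group_set n).

Lemma Sigma0_sub_AGL n : Sigma0 n \subset AGL n.
Proof. by apply/subsetP => p /setIdP[]. Qed.

(** Each squaring fixes one more coordinate: a [q] fixing those before [i] adds the same amount to
    coordinate [i] at [x] and at [q x], and the two cancel. *)
Lemma Sigma0_expg n (p : {perm 'rV['F_2]_n}) (i : nat) x :
  (i <= n)%N -> p \in Sigma0 n -> agree i ((p ^+ (2 ^ i))%g x) x.
Proof.
move=> + hp; elim: i x => [|i IH] x hi; first exact: agree0.
have q_in : (p ^+ (2 ^ i))%g \in Sigma0 n by rewrite groupX.
rewrite expnSr expgM; set q := (p ^+ (2 ^ i))%g in q_in IH *.
rewrite (agreeS (Ordinal hi)) expgS expg1 permM /=.
have ax := IH x (ltnW hi); have aqx := IH (q x) (ltnW hi).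
apply/andP; split.
  by apply/agreeP => j ji; rewrite (agreeP _ _ _ aqx j ji) (agreeP _ _ _ ax j ji).
move: q_in => /setIdP[_ /unitriP/(_ (q x) x (Ordinal hi) ax)].
move/eqP; rewrite subr_eq -addrA => /eqP->.
move: (q x 0 _) (x 0 _) => a b; apply/eqP.
by case: (F2P a) => ->; case: (F2P b) => ->; apply/eqP.
Qed.

Lemma Sigma0_pgroup n : (2.-group (Sigma0 n))%g.
Proof.
rewrite -pnat_exponent; apply: (@pnat_dvd _ (2 ^ n)%N); last by rewrite pnatX pnat_id.
apply/exponentP => p hp; apply/permP => x; rewrite perm1; apply: agree_eq.
exact: Sigma0_expg.
Qed.

(** * Shears along a vector *)

Section Shear.
Variables (n : nat) (phi : 'rV['F_2]_n -> 'F_2) (w : 'rV['F_2]_n).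
Hypothesis phi_w : forall x, phi (x + w) = phi x.

(** Moving along [w] preserves [phi], so applying the map twice adds [phi x *: w] twice, which is
    0. *)
Lemma shear_subproof : injective (fun x => x + phi x *: w).
Proof.
suff: involutive (fun x => x + phi x *: w) by exact: inv_inj.
move=> x; rewrite -addrA -scalerDl.
have -> : phi (x + phi x *: w) = phi x.
  by case: (F2P (phi x)) => e; rewrite [in LHS]e ?scale0r ?addr0 ?scale1r.
by rewrite F2_addrr scale0r addr0.
Qed.

Definition shear := perm shear_subproof.

Lemma shearE x : shear x = x + phi x *: w.
Proof. by rewrite permE. Qed.

Lemma shear_affine : is_affine phi -> is_affine shear.
Proof.
move=> h; have /affineP hx := affineD (affine_id n) (affineZ w h).
by apply/affineP => x y; rewrite !shearE; apply: hx.
Qed.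

Lemma shear_unitri :
  (forall (i : 'I_n) x y, agree i x y -> phi x * w 0 i = phi y * w 0 i) ->
  unitri shear.
Proof.
move=> h; apply/unitriP => x y i /h e.
by rewrite !shearE !mxE e addrC addrK addrC addrK.
Qed.

Lemma shear_Sigma0 : is_affine phi ->
  (forall (i : 'I_n) x y, agree i x y -> phi x * w 0 i = phi y * w 0 i) ->
  shear \in Sigma0 n.
Proof. by move=> h1 h2; rewrite Sigma0P shear_affine // shear_unitri. Qed.

End Shear.

(** * Flag preservation by the normalizer, and the Sylow property *)

(* [s] maps [x] to [y] and fixes a point that agrees with [x] up to [i]; its
   conjugate by [g] is again unitriangular. *)
Lemma norm_agree n (g : {perm 'rV['F_2]_n}) (i : nat) x y : (i <= n)%N ->
  (g \in 'N(Sigma0 n))%g -> agree i x y -> agree i (g x) (g y).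
Proof.
move=> + gN; elim: i x y => [|k IH] x y kn axy; first exact: agree0.
(* The constant [x 0 i + 1] makes [phi] equal to 1 at [x] and to 0 once coordinate [i] is
   flipped. *)
pose i := Ordinal kn; pose w := x + y; pose phi (z : 'rV['F_2]_n) := z 0 i + (x 0 i + 1).
have w0 (j : 'I_n) : (j <= i)%N -> w 0 j = 0.
  by move=> ji; rewrite mxE (agreeP _ _ _ axy j ji) F2_addrr.
have phi_w z : phi (z + w) = phi z by rewrite /phi mxE w0 // addr0.
pose s := shear phi_w.
have sS : s \in Sigma0 n.
  apply: shear_Sigma0 => [|j u v auv].
    exact: affineD (affine_coord i) (affine_cst _ _).
  have [ji|ij] := leqP j i; first by rewrite w0 // !mulr0.
  by rewrite /phi (agreeP _ _ _ auv i ij).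
have sx : s x = y.
  by rewrite shearE /phi addrA F2_addrr add0r scale1r addrA F2_addrr_row add0r.
pose d : 'rV['F_2]_n := delta_mx 0 i.
have sxd : s (x + d) = x + d.
  rewrite shearE /phi !mxE !eqxx.
  have -> : x 0 i + 1%:R + (x 0 i + 1) = 0 by exact: F2_addrr.
  by rewrite scale0r addr0.
have : (s ^ g)%g \in Sigma0 n by rewrite memJ_norm.
move=> /setIdP[_ /unitriP tri].
have ad : agree i x (x + d) by rewrite agreeC agree_add_delta.
have gd : agree i (g x) (g (x + d)).
  by apply: IH ad; apply: ltnW.
apply/agreeP => j ji.
(* The conjugate of [s] shifts the [j]-th coordinates of [g x] and [g (x + d)] equally, hence by
   0. *)
have gdj : agree j (g x) (g (x + d)) by exact: agreeW gd.
have := tri _ _ _ gdj; rewrite !permJ sx sxd subrr => /eqP.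
by rewrite subr_eq0 => /eqP.
Qed.

Lemma eq_affine n (W : zmodType) (f g : 'rV['F_2]_n -> W) :
  f =1 g -> is_affine f -> is_affine g.
Proof. by move=> fg /affineP h; apply/affineP => x y; rewrite -!fg. Qed.

(** Both [g] and its inverse preserve agreement, so [x] and [y] agree at [i] exactly when their
    images do; with only two values per coordinate the displacements are then equal. *)
Lemma norm_unitri n (g : {perm 'rV['F_2]_n}) : g \in 'N(Sigma0 n)%g -> unitri g.
Proof.
move=> gN; apply/unitriP => x y i axy.
have gxy := norm_agree (ltnW (ltn_ord i)) gN axy.
have iff : (x 0 i == y 0 i) = (g x 0 i == g y 0 i).
  have E1 : agree i.+1 x y -> agree i.+1 (g x) (g y) by exact: norm_agree.
  have E2 : agree i.+1 (g x) (g y) -> agree i.+1 x y.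
    rewrite -{2}(permK g x) -{2}(permK g y); apply: norm_agree => //.
    exact: groupVr.
  rewrite !agreeS axy gxy /= in E1 E2; exact/idP/idP.
move: iff; move: (x 0 i) (y 0 i) (g x 0 i) (g y 0 i) => a b c d.
by case: (F2P a) => ->; case: (F2P b) => ->; case: (F2P c) => ->;
   case: (F2P d) => -> h; apply/eqP; move: h.
Qed.

(* Sigma0 is its own normalizer in AGL, and normalizers grow in 2-groups. *)
Lemma Sigma0_Sylow n : (Sigma0_group n \in 'Syl_2(AGL n))%g.
Proof.
have [P PS sSP] := Sylow_superset (Sigma0_sub_AGL n) (Sigma0_pgroup n).
suff -> : Sigma0_group n = P by rewrite inE.
apply/val_inj/eqP; rewrite /= eqEproper sSP /=; apply/negP => prop.
have := nilpotent_proper_norm (pgroup_nil (pHall_pgroup PS)) prop.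
rewrite properE => /andP[_ /negP]; apply; apply/subsetP => g /setIP[gP gN].
apply/setIdP; split; last exact: norm_unitri.
exact: subsetP (pHall_sub PS) g gP.
Qed.

(** * Shears in the last coordinate *)

(** No displacement depends on the last coordinate. *)
Lemma unitri_last m (p : {perm 'rV['F_2]_m.+1}) x (c : 'F_2) :
  unitri p -> p (x + c *: delta_mx 0 ord_max) = p x + c *: delta_mx 0 ord_max.
Proof.
move=> hp; pose e : 'rV['F_2]_m.+1 := delta_mx 0 ord_max.
case: (F2P c) => ->; first by rewrite !scale0r !addr0.
have a : agree m (x + e) x by exact: (agree_add_delta ord_max).
rewrite scale1r; apply: agree_eq; rewrite (agreeS ord_max); apply/andP; split.
  have /agreeP h := unitri_agree hp a; apply/agreeP => j jm.
  by rewrite h //; have /agreeP -> := agree_add_delta ord_max (p x).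
have /unitriP/(_ (x + e) x ord_max a)/eqP := hp.
by rewrite subr_eq !mxE !eqxx addrA subrK.
Qed.

Definition last_free m (f : 'rV['F_2]_m.+1 -> 'F_2) :=
  forall x y, agree m x y -> f x = f y.

Lemma last_free_add m (f : 'rV['F_2]_m.+1 -> 'F_2) :
  last_free f -> forall x, f (x + delta_mx 0 ord_max) = f x.
Proof. by move=> h x; apply: h; apply: (agree_add_delta ord_max). Qed.

Definition top_shear m (f : 'rV['F_2]_m.+1 -> 'F_2) (h : last_free f) :=
  shear (last_free_add h).

Lemma top_shearE m (f : 'rV['F_2]_m.+1 -> 'F_2) (h : last_free f) x :
  top_shear h x = x + f x *: delta_mx 0 ord_max.
Proof. exact: shearE. Qed.

Lemma top_shear_unitri m (f : 'rV['F_2]_m.+1 -> 'F_2) (h : last_free f) :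
  unitri (top_shear h).
Proof.
apply: shear_unitri => i x y a; rewrite mxE eqxx /=.
by case: eqP a => [-> /h -> //|_ _]; rewrite !mulr0.
Qed.

Lemma top_shear_Sigma0 m (f : 'rV['F_2]_m.+1 -> 'F_2) (h : last_free f) :
  is_affine f -> top_shear h \in Sigma0 m.+1.
Proof. by move=> fA; rewrite Sigma0P shear_affine // top_shear_unitri. Qed.

Lemma affine_of_top_shear m (f : 'rV['F_2]_m.+1 -> 'F_2) (h : last_free f) :
  is_affine (top_shear h) -> is_affine f.
Proof.
move=> /affine_coordP/(_ ord_max) A.
apply: eq_affine (affineD A (affine_coord ord_max)) => x /=.
by rewrite top_shearE !mxE !eqxx mulr1 addrAC F2_addrr add0r.
Qed.

(** Since [g] commutes with translations along the last basis vector [e], conjugating the shear by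
    [x_i] with the inverse of [g] gives the shear [x + (g x)_i e], which is again affine. *)
Lemma norm_coord_affine m (g : {perm 'rV['F_2]_m.+1}) (i : 'I_m.+1) :
  g \in 'N(Sigma0 m.+1)%g -> (i < m)%N -> is_affine (fun x => g x 0 i).
Proof.
move=> gN im.
have h : last_free (fun x : 'rV['F_2]_m.+1 => x 0 i).
  by move=> x y /agreeP; apply.
have kS := top_shear_Sigma0 h (affine_coord i).
have : (top_shear h ^ g^-1)%g \in Sigma0 m.+1 by rewrite memJ_norm // groupV.
rewrite Sigma0P => /andP[/affine_coordP/(_ ord_max) A _].
apply: eq_affine (affineD A (affine_coord ord_max)) => x /=.
rewrite -{1}(permK g x) permJ top_shearE -unitri_last ?norm_unitri // permK.
by rewrite !mxE !eqxx mulr1 addrAC F2_addrr add0r.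
Qed.

(* [f] is the last coordinate of [g x] minus that of [x], so that precomposing
   [g] with the shear by [f] makes the last coordinate affine as well. *)
Lemma norm_decomp m (g : {perm 'rV['F_2]_m.+1}) : g \in 'N(Sigma0 m.+1)%g ->
  exists f (h : @last_free m f), (top_shear h * g)%g \in Sigma0 m.+1.
Proof.
move=> gN; have gU := norm_unitri gN.
have h : last_free (fun x => g x 0 ord_max - x 0 ord_max).
  by move=> x y a; move/unitriP: gU; apply.
exists _, h; rewrite Sigma0P unitriM ?top_shear_unitri // andbT.
apply/affine_coordP => i.
have [im|mi] := ltnP i m.
  apply: eq_affine (norm_coord_affine gN im) => x.
  rewrite permM top_shearE unitri_last // !mxE !eqxx /=.
  by case: eqP im => [->|_ _]; rewrite ?ltnn // mulr0 addr0.
have -> : i = ord_max by apply/val_inj/eqP; rewrite /= eqn_leq mi -ltnS ltn_ord.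
apply: eq_affine (affine_coord ord_max) => x.
rewrite permM top_shearE unitri_last // !mxE !eqxx mulr1.
by rewrite addrA F2_addrr add0r F2_oppr.
Qed.

Lemma last_freeZ m (f : 'rV['F_2]_m.+1 -> 'F_2) x (c : 'F_2) :
  last_free f -> f (x + c *: delta_mx 0 ord_max) = f x.
Proof.
by move=> h; case: (F2P c) => ->; rewrite ?scale0r ?addr0 // scale1r last_free_add.
Qed.

(** The shear [k] is an involution and [p] commutes with translations along the last basis vector
    [e], so [p ^ k] sends [x] to [p x + (f x + f (p x)) e]. *)
Lemma norm_top_shear_diff m (f : 'rV['F_2]_m.+1 -> 'F_2) (h : last_free f) p :
  top_shear h \in 'N(Sigma0 m.+1)%g -> p \in Sigma0 m.+1 ->
  is_affine (fun x => f (p x) + f x).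
Proof.
move=> kN pS; set k := top_shear h in kN.
have kK y : k (k y) = y.
  by rewrite !top_shearE last_freeZ // -addrA -scalerDl F2_addrr scale0r addr0.
have : (p ^ k)%g \in Sigma0 m.+1 by rewrite memJ_norm.
move: pS; rewrite !Sigma0P => /andP[/affine_coordP/(_ ord_max) pA pU].
move=> /andP[/affine_coordP/(_ ord_max) A _].
apply: eq_affine (affineD A pA) => y /=.
rewrite -{1}(kK y) permJ [k y]top_shearE unitri_last // top_shearE last_freeZ //.
rewrite !mxE !eqxx !mulr1; move: (p y 0 _) (f y) (f (p y)) => a b c.
clear; F2_decide.
Qed.

(** * Polar forms *)

(** The second difference of [f] at 0, written without signs in characteristic 2. *)
Definition polar n (f : 'rV['F_2]_n -> 'F_2) u v := f (u + v) + f u + f v + f 0.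

Lemma polarC n (f : 'rV['F_2]_n -> 'F_2) u v : polar f u v = polar f v u.
Proof. by rewrite /polar addrC [u + v]addrC addrC -!addrA (addrCA (f u)). Qed.

Lemma polar_diag n (f : 'rV['F_2]_n -> 'F_2) u : polar f u u = 0.
Proof.
rewrite /polar F2_addrr_row; move: (f 0) (f u); clear=> a b; F2_decide.
Qed.

Lemma polar_affine n (f : 'rV['F_2]_n -> 'F_2) :
  (forall u v, polar f u v = 0) -> is_affine f.
Proof.
move=> h; apply/affineP => u v; move/eqP: (h u v); rewrite /polar.
move: (f _) (f u) (f v) (f 0); clear=> a b c d.
F2_decide.
Qed.

(** With [D x = f (x + v) + f x], the polar form at [(u, v)] is [D u + D 0], so affinity of [D] is
    additivity in [u]. *)
Lemma polarDl n (f : 'rV['F_2]_n -> 'F_2) :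
  (forall v, is_affine (fun x => f (x + v) + f x)) ->
  forall u u' v, polar f (u + u') v = polar f u v + polar f u' v.
Proof.
move=> h u u' v; have /affineP/(_ u u') := h v; rewrite /polar add0r.
move: (f (u + u' + v)) (f (u + u')) (f (u + v)) (f (u' + v)) => a b c d.
move: (f u) (f u') (f v) (f 0) => i j k l E.
rewrite -(addrA _ k l) E; move: (k + l) => s; clear.
F2_decide.
Qed.

Lemma additive_eq0 n (F : 'rV['F_2]_n -> 'F_2) :
  (forall u v, F (u + v) = F u + F v) -> (forall i, F (delta_mx 0 i) = 0) ->
  forall u, F u = 0.
Proof.
move=> FD Fd u; have F0 : F 0 = 0 by apply: (addIr (F 0)); rewrite -FD !add0r.
rewrite (row_sum_delta u); elim/big_ind: _ => // [x y hx hy|i _].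
  by rewrite FD hx hy addr0.
by case: (F2P (u 0 i)) => ->; rewrite ?scale0r ?scale1r.
Qed.

Lemma translation_Sigma0 n (v : 'rV['F_2]_n) : perm (@addIr _ v) \in Sigma0 n.
Proof.
rewrite Sigma0P; apply/andP; split.
  by apply/affineP => x y; rewrite !permE add0r -addrA addrACA.
by apply/unitriP => x y k _; rewrite !permE !mxE ![_ + v 0 k - _]addrAC !subrr.
Qed.

Lemma norm_top_shear_deriv m (f : 'rV['F_2]_m.+1 -> 'F_2) (h : last_free f) v :
  top_shear h \in 'N(Sigma0 m.+1)%g -> is_affine (fun x => f (x + v) + f x).
Proof.
move=> kN; have := norm_top_shear_diff kN (translation_Sigma0 v).
by apply: eq_affine => x; rewrite permE.
Qed.

(** An affine summand does not change the polar form, so [f] and [f \o p] have the same one. *)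
Lemma polar_comp n (f : 'rV['F_2]_n -> 'F_2) (p : 'rV['F_2]_n -> 'rV['F_2]_n) :
  (forall u v, p (u + v) = p u + p v) -> is_affine (fun x => f (p x) + f x) ->
  forall u v, polar f (p u) (p v) = polar f u v.
Proof.
move=> pD /affineP h u v; have := h u v.
have -> : p 0 = 0 by apply: (addIr (p 0)); rewrite -pD !add0r.
rewrite pD F2_addrr addr0 /polar => /eqP.
move: (f (p u + p v)) (f (u + v)) (f (p u)) (f u) (f (p v)) (f v) (f 0).
clear; move=> a b c d i j k; F2_decide.
Qed.

(** * The normalizer in dimension at least three *)

Section AtLeastThree.
Variable m : nat.
Local Notation V := 'rV['F_2]_m.+3.
Let i0 : 'I_m.+3 := ord0.
Let i1 : 'I_m.+3 := lift ord0 ord0.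

Definition quad (x : V) : 'F_2 := x 0 ord0 * x 0 (lift ord0 ord0).

(** Indices 0 and 1 both precede the last one because the dimension is at least 3. *)
Lemma quad_last_free : last_free quad.
Proof. by move=> x y /agreeP h; rewrite /quad !h. Qed.

Lemma polar_quad u v : polar quad u v = u 0 i0 * v 0 i1 + u 0 i1 * v 0 i0.
Proof.
rewrite /polar /quad -/i0 -/i1 !mxE.
move: (u 0 i0) (u 0 i1) (v 0 i0) (v 0 i1); clear=> a b c d; F2_decide.
Qed.

(* The polar form is invariant under the transvection [e_a |-> e_a + e_j], where
   [a < j] and [a <> i]; such an [a] exists exactly because [j >= 2]. *)
Lemma norm_polar_basis (f : V -> 'F_2) (h : last_free f) (i j : 'I_m.+3) :
  top_shear h \in 'N(Sigma0 m.+3)%g -> (1 < j)%N ->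
  polar f (delta_mx 0 i) (delta_mx 0 j) = 0.
Proof.
move=> kN j1; pose a := if i == i0 then i1 else i0.
have aj : (a < j)%N by rewrite /a; case: ifP => _ //; apply: ltnW.
have ai : (i == a) = false by rewrite /a; case: (eqVneq i i0) => [-> //|/negbTE].
have ja : (j == a) = false by apply/negbTE; rewrite neq_ltn aj orbT.
have phi_w (z : V) : (z + delta_mx 0 j) 0 a = z 0 a.
  by rewrite !mxE eqxx eq_sym ja addr0.
pose p := shear phi_w.
have pS : p \in Sigma0 m.+3.
  apply: (shear_Sigma0 phi_w (affine_coord a)) => k x y /agreeP axy.
  rewrite mxE eqxx /=; case: eqP => [kj|_]; last by rewrite !mulr0.
  by rewrite axy // kj.
have pD u v : p (u + v) = p u + p v by rewrite !shearE mxE scalerDl addrACA.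
have inv := polar_comp pD (norm_top_shear_diff kN pS).
have fD v := norm_top_shear_deriv v kN.
(* As [p] fixes [e_i] and sends [e_a] to [e_a + e_j], additivity cancels the value at
   [(e_i, e_a)]. *)
have := inv (delta_mx 0 i) (delta_mx 0 a).
rewrite !shearE !mxE !eqxx eq_sym ai /= scale0r addr0 scale1r.
rewrite polarC (polarDl fD) polarC => /eqP; rewrite addrC -subr_eq0 addrK => /eqP.
by rewrite polarC.
Qed.

(** The polar form of [f] can be nonzero on basis vectors only at the first two; adding [b * quad]
    cancels that value [b], and a vanishing polar form means affine. *)
Lemma norm_quadratic (f : V -> 'F_2) (h : last_free f) :
  top_shear h \in 'N(Sigma0 m.+3)%g ->
  exists b : 'F_2, is_affine (fun x => f x + b * quad x).
Proof.
move=> kN; pose b := polar f (delta_mx 0 i0) (delta_mx 0 i1); exists b.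
pose g x := f x + b * quad x.
have fD v := norm_top_shear_deriv v kN.
have gE u v : polar g u v = polar f u v + b * polar quad u v.
  by rewrite /polar /g; ring.
have gD u u' v : polar g (u + u') v = polar g u v + polar g u' v.
  by rewrite !gE (polarDl fD) !polar_quad !mxE; ring.
have gD' v u u' : polar g v (u + u') = polar g v u + polar g v u'.
  by rewrite polarC gD !(polarC _ v).
have gb (i j : 'I_m.+3) : polar g (delta_mx 0 i) (delta_mx 0 j) = 0.
  have big (i' j' : 'I_m.+3) : (1 < j')%N -> polar g (delta_mx 0 i') (delta_mx 0 j') = 0.
    move=> hj; rewrite gE (norm_polar_basis _ kN hj) polar_quad !mxE !eqxx /=.
    have -> : (i0 == j') = false by case: j' hj => [[]].
    have -> : (i1 == j') = false by case: j' hj => [[|[]]].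
    by rewrite !mulr0 addr0 mulr0 addr0.
  have small (k : 'I_m.+3) : ~~ (1 < k)%N -> k = i0 \/ k = i1.
    by case: k => [[|[|//]] hk] _; [left|right]; apply: val_inj.
  have g01 : polar g (delta_mx 0 i0) (delta_mx 0 i1) = 0.
    by rewrite gE polar_quad -/b !mxE !eqxx /= mulr0 mulr1 addr0 mulr1 F2_addrr.
  have [hj|/small hj] := boolP (1 < j)%N; first exact: big.
  have [hi|/small hi] := boolP (1 < i)%N; first by rewrite polarC big.
  by case: hi hj => -> [] ->; rewrite ?polar_diag // polarC.
apply: polar_affine; rewrite -/g => u v.
apply: (additive_eq0 (F := fun x => polar g x v)) => [x y|i]; first exact: gD.
apply: (additive_eq0 (F := fun x => polar g (delta_mx 0 i) x)) => [x y|j].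
  exact: gD'.
exact: gb.
Qed.

Definition quad_shear := top_shear quad_last_free.

Lemma quad_shear_notin : quad_shear \notin Sigma0 m.+3.
Proof.
apply/negP; rewrite Sigma0P => /andP[/affine_of_top_shear/affineP h _].
(* At these two vectors the affine identity would read 1 = 0. *)
by have /eqP := h (delta_mx 0 i0) (delta_mx 0 i1); rewrite /quad !mxE.
Qed.

Lemma quad_shearV : (quad_shear^-1 = quad_shear)%g.
Proof.
apply/eqP; rewrite eq_invg_mul; apply/eqP/permP => y.
rewrite permM perm1 !top_shearE last_freeZ; last exact: quad_last_free.
by rewrite -addrA -scalerDl F2_addrr scale0r addr0.
Qed.

(** The conjugate of [p] differs from [p] by [quad x + quad (p x)] in the last coordinate, so
    affinity of this function suffices. *)
Lemma quad_shear_norm : quad_shear \in 'N(Sigma0 m.+3)%g.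
Proof.
rewrite inE; apply/subsetP => _ /imsetP[p pS ->].
have kU : unitri quad_shear by exact: top_shear_unitri.
have kK := quad_shearV.
move: (pS); rewrite !Sigma0P => /andP[pA pU].
have cU : unitri (p ^ quad_shear)%g by rewrite /conjg kK !unitriM.
rewrite cU andbT.
pose r x := p x 0 i1 - x 0 i1.
have [a p0] : exists a, forall x, p x 0 i0 = x 0 i0 + a.
  exists (p 0 0 i0) => x.
  have /unitriP/(_ x 0 i0 (agree0 _ _))/eqP := pU.
  by rewrite subr_eq mxE subr0 addrC => /eqP.
(* The displacement [r] depends on [x_0] alone, and every function on F_2 is affine. *)
have [b [c p1]] : exists b c, forall x, p x 0 i1 = x 0 i1 + (b + x 0 i0 * c).
  exists (r 0), (r (delta_mx 0 i0) - r 0) => x.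
  apply/eqP; rewrite addrC -subr_eq; apply/eqP; rewrite -/(r x).
  have ag (y : V) : x 0 i0 = y 0 i0 -> r x = r y.
    move=> e; have /unitriP := pU; apply; apply/agreeP => j.
    by case: j => [[|//] hj] _; rewrite (_ : Ordinal hj = i0) //; apply: val_inj.
  case: (F2P (x 0 i0)) => e.
    by rewrite e mul0r addr0; apply: ag; rewrite e mxE.
  by rewrite e mul1r addrC subrK; apply: ag; rewrite e mxE !eqxx.
(* The products [x_0 x_1] cancel, and the square of [x_0] is [x_0]. *)
have qA : is_affine (fun x => quad x + quad (p x)).
  apply/affineP => x y; rewrite /quad -/i0 -/i1 !p0 !p1 !mxE.
  move: (x 0 i0) (x 0 i1) (y 0 i0) (y 0 i1) => d e i j.
  clear -a b c; F2_decide.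
pose e : V := delta_mx 0 ord_max.
have /affineP A := affineD pA (affineZ e qA).
have E x : (p ^ quad_shear)%g x = p x + (quad x + quad (p x)) *: e.
  rewrite /conjg kK !permM [quad_shear x]top_shearE unitri_last // top_shearE.
  rewrite last_freeZ; last exact: quad_last_free.
  by rewrite -addrA -scalerDl.
by apply/affineP => x y; rewrite !E; apply: A.
Qed.

Lemma norm_Sigma0E :
  'N(Sigma0 m.+3)%g = Sigma0 m.+3 :|: (Sigma0 m.+3 :* quad_shear)%g.
Proof.
apply/setP => g; apply/idP/setUP => [gN|[gS|]].
- have [f [h hS]] := norm_decomp gN.
  have kN : top_shear h \in 'N(Sigma0 m.+3)%g.
    rewrite -(groupMr _ gN); exact: subsetP (normG (Sigma0_group _)) _ hS.
  have [b bA] := norm_quadratic kN.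
  have [b0|b1] := F2P b.
    left; rewrite -(groupMl g (x := top_shear h)) //.
    apply: top_shear_Sigma0; apply: eq_affine bA => x.
    by rewrite b0 mul0r addr0.
  right; have fq : last_free (fun x => f x + quad x).
    by move=> x y a; rewrite (h x y) // (quad_last_free a).
  have fqS : top_shear fq \in Sigma0 m.+3.
    by apply: top_shear_Sigma0; apply: eq_affine bA => x; rewrite b1 mul1r.
  have tE : (top_shear fq * quad_shear = top_shear h)%g.
    apply/permP => x; rewrite permM !top_shearE last_freeZ; last exact: quad_last_free.
    by rewrite -addrA -scalerDl -(addrA (f x)) F2_addrr addr0.
  (* The right coset is also a left one, so the claim is that [quad_shear * g] lies in [Sigma0];
     multiplying by [top_shear fq] turns it into [top_shear h * g]. *)
  rewrite (norm_rlcoset quad_shear_norm) mem_lcoset quad_shearV.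
  by rewrite -(groupMl _ fqS) mulgA tE.
- exact: subsetP (normG (Sigma0_group _)) _ gS.
case/rcosetP => s sS ->; rewrite groupM ?quad_shear_norm //=.
exact: subsetP (normG (Sigma0_group _)) _ sS.
Qed.

Lemma norm_Sigma0_index : #|'N(Sigma0 m.+3) : Sigma0 m.+3|%g = 2%N.
Proof.
have cN : #|'N(Sigma0 m.+3)%g| = (#|Sigma0 m.+3| * 2)%N.
  rewrite norm_Sigma0E cardsU disjoint_setI0.
    by rewrite cards0 subn0 card_rcoset addnn muln2.
  apply/pred0P => x /=; apply/negbTE/andP => [[xS /rcosetP[s sS xE]]].
  by move: xS; rewrite xE groupMl // (negbTE quad_shear_notin).
apply/eqP; rewrite -(eqn_pmul2l (cardG_gt0 (Sigma0_group m.+3))) -cN.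
by rewrite (Lagrange (normG (Sigma0_group m.+3))).
Qed.

End AtLeastThree.

(* Transfer to an arbitrary Sylow 2-subgroup by conjugacy *)
Local Close Scope ring_scope.

Theorem mainTheorem16 (n : nat) (Sigma : {group {perm 'rV['F_2]_n}}) :
  2 < n -> (Sigma \in 'Syl_2(AGL n))%g -> #|'N(Sigma) : Sigma|%g = 2.
Proof.
case: n Sigma => [|[|[|m]]] // Sigma _; have := Sigma0_Sylow m.+3; rewrite !inE => S0 SS.
have [x _ ->] := Sylow_trans (G := AGL_group _) S0 SS.
by rewrite /= normJ indexJg norm_Sigma0_index.
Qed.
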